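(* Let $A,B\in\Pi_n(\mathbb{C})^\circ$ be positive definite $n\times n$ Hermitian matrices. Let $\lambda_+(A^{-1}B):=\max\{\lambda:\lambda\in\sigma(A^{-1}B)\}$ and $\lambda_-(A^{-1}B):=\min\{\lambda:\lambda\in\sigma(A^{-1}B)\}$, and let $k$ be the number of eigenvalues $\mu$ of $A^{-1}B$, counting multiplicities, such that \[ \max\{\mu,\mu^{-1}\}\neq\max\{\lambda_+(A^{-1}B),\lambda_-(A^{-1}B)^{-1}\}. \] Then \[ \dim(\mathrm{aff}\,\mathcal{M}(A,B))=k^2 . \]
   Context: $\Pi_n(\mathbb{C})$ is the cone of positive-semidefinite matrices in the real vector space of $n\times n$ complex Hermitian matrices, and $\Pi_n(\mathbb{C})^\circ$ is its interior, the set of positive definite matrices. For $A,B\in\Pi_n(\mathbb{C})^\circ$ the eigenvalues $\lambda_i(A^{-1}B)$ of $A^{-1}B$ are real and positive, and $\sigma(A^{-1}B)$ is their set. Thompson's metric is $d_T(A,B):=\max_i|\log\lambda_i(A^{-1}B)|$, and the midpoints set is \[ \mathcal{M}(A,B):=\{C\in\Pi_n(\mathbb{C})^\circ: d_T(A,C)=\tfrac12 d_T(A,B)=d_T(C,B)\}. \] $\mathrm{aff}$ denotes the affine span in the real vector space of $n\times n$ Hermitian matrices, and $\dim$ its real dimension. *)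

(* Defs.v *)
From HB Require Import structures.
From mathcomp Require Import all_boot all_order all_algebra.
From mathcomp Require Import sesquilinear spectral complex.
From mathcomp Require Import classical_sets reals exp.

Set Implicit Arguments.
Unset Strict Implicit.
Unset Printing Implicit Defensive.

Import Order.TTheory GRing.Theory Num.Theory.
Local Open Scope ring_scope.
Local Open Scope sesquilinear_scope.
Local Open Scope complex_scope.
Local Open Scope classical_set_scope.

Definition herm (R : rcfType) (n : nat) : Type :=
  @hermitian_matrix R[i] n false (@Num.conj R[i]).

Definition hval (R : rcfType) (n : nat) (A : herm R n) : 'M[R[i]]_n :=
  mx_of_hermitian A.

Section HermVector.
Variables (R : rcfType) (n : nat).
Local Notation C := R[i].
Local Notation H := (herm R n).
Local Notation hmx := (@hermitianmx C n false (@Num.conj C)).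

Lemma hermP (M : 'M[C]_n) :
  reflect (forall i j, M i j = (M j i)^*) (M \is hmx).
Proof.
apply: (iffP (is_hermitianmxP _ _ _)); rewrite expr0 scale1r.
  by move=> E i j; rewrite {1}E !mxE.
by move=> E; apply/matrixP=> i j; rewrite !mxE E.
Qed.

HB.instance Definition _ := [isSub of H for @hval R n].
HB.instance Definition _ := [Choice of H by <:].

Lemma hval_inj : injective (@hval R n).
Proof. exact: (@val_inj _ _ H). Qed.

Fact herm0_subproof : 0 \is hmx.
Proof. by apply/hermP => i j; rewrite !mxE conjc0. Qed.
Fact hermN_subproof (A : H) : - hval A \is hmx.
Proof.
have /hermP hA : hval A \is hmx by exact: (valP A).
by apply/hermP => i j; rewrite !mxE hA rmorphN.
Qed.
Fact hermD_subproof (A B : H) : hval A + hval B \is hmx.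
Proof.
have /hermP hA : hval A \is hmx by exact: (valP A).
have /hermP hB : hval B \is hmx by exact: (valP B).
by apply/hermP => i j; rewrite !mxE hA hB rmorphD.
Qed.

Definition herm0 : H := HermitianMx herm0_subproof.
Definition herm_opp (A : H) : H := HermitianMx (hermN_subproof A).
Definition herm_add (A B : H) : H := HermitianMx (hermD_subproof A B).

Fact herm_addA : associative herm_add.
Proof. by move=> A B D; apply: hval_inj; apply: addrA. Qed.
Fact herm_addC : commutative herm_add.
Proof. by move=> A B; apply: hval_inj; apply: addrC. Qed.
Fact herm_add0 : left_id herm0 herm_add.
Proof. by move=> A; apply: hval_inj; apply: add0r. Qed.
Fact herm_addN : left_inverse herm0 herm_opp herm_add.
Proof. by move=> A; apply: hval_inj; apply: addNr. Qed.

HB.instance Definition _ :=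
  GRing.isZmodule.Build H herm_addA herm_addC herm_add0 herm_addN.

Fact herm_scale_subproof (a : R) (A : H) : a%:C *: hval A \is hmx.
Proof.
have /hermP hA : hval A \is hmx by exact: (valP A).
by apply/hermP => i j; rewrite !mxE hA rmorphM /= oppr0.
Qed.

Definition herm_scale (a : R) (A : H) : H := HermitianMx (herm_scale_subproof a A).

Lemma hval_scale a A : hval (herm_scale a A) = a%:C *: hval A.
Proof. by []. Qed.

Lemma hvalD (A B : H) : hval (A + B) = hval A + hval B.
Proof. by []. Qed.

Fact herm_scaleA a b A : herm_scale a (herm_scale b A) = herm_scale (a * b) A.
Proof. by apply: hval_inj; rewrite !hval_scale scalerA rmorphM. Qed.
Fact herm_scale1 : left_id 1 herm_scale.
Proof. by move=> A; apply: hval_inj; rewrite hval_scale scale1r. Qed.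
Fact herm_scaleDr : right_distributive herm_scale +%R.
Proof.
by move=> a A B; apply: hval_inj; rewrite !(hval_scale, hvalD) scalerDr.
Qed.
Fact herm_scaleDl A : {morph herm_scale^~ A : a b / a + b}.
Proof.
by move=> a b; apply: hval_inj; rewrite !(hval_scale, hvalD) rmorphD scalerDl.
Qed.

HB.instance Definition _ := GRing.Zmodule_isLmodule.Build R H
  herm_scaleA herm_scale1 herm_scaleDr herm_scaleDl.

Lemma hvalZ (a : R) (A : H) : hval (a *: A) = a%:C *: hval A.
Proof. exact: hval_scale. Qed.

(* Real coordinates: the real parts on and above the diagonal, the imaginary
   parts below it. *)
Definition herm_coord (A : H) : 'rV[R]_(n * n) :=
  mxvec (\matrix_(i, j) if (i <= j)%N then complex.Re (hval A i j)
                        else complex.Im (hval A i j)).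

Definition herm_of_mx (M : 'M[R]_n) : 'M[C]_n :=
  \matrix_(i, j) if i == j then (M i i)%:C
                 else if (i < j)%N then M i j -i* M j i else M j i +i* M i j.

Fact herm_of_mx_subproof M : herm_of_mx M \is hmx.
Proof.
apply/hermP => i j; rewrite !mxE; case: (eqVneq i j) => [->|nij].
  by rewrite /= oppr0.
case: (ltngtP i j) => [_|_|/val_inj E] //=; first by rewrite opprK.
by rewrite E eqxx in nij.
Qed.

Fact herm_vector_axiom : vector_axiom_def (n * n) H.
Proof.
exists herm_coord.
  move=> a A B; rewrite /herm_coord -linearP /=; congr mxvec.
  apply/matrixP => i j; rewrite !mxE.
  by case: (hval A i j) (hval B i j) => [x y] [z t] /=;
    case: ifP => _; rewrite !mul0r ?subr0 ?addr0.
exists (fun v : 'rV_(n * n) =>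
          HermitianMx (herm_of_mx_subproof (vec_mx v)) : H) => [A|v].
  apply: hval_inj; rewrite /herm_coord mxvecK /hval /=.
  have /hermP hA : hval A \is hmx by exact: (valP A).
  apply/matrixP => i j; rewrite !mxE; case: (eqVneq i j) => [<-|nij].
    rewrite leqnn; have := hA i i; case: (hval A i i) => x y [] /= /eqP.
    by rewrite -addr_eq0 -mulr2n mulrn_eq0 /= => /eqP ->.
  case: (ltngtP i j) => [lij|lji|/val_inj E]; last by rewrite E eqxx in nij.
    by rewrite (hA j i); case: (hval A i j) => x y /=; rewrite opprK.
  by rewrite (hA j i); case: (hval A i j) => x y /=.
apply: (can_inj vec_mxK); rewrite mxvecK.
apply/matrixP => i j; rewrite /hval /= !mxE.
case: (eqVneq i j) => [<-|nij]; first by rewrite leqnn.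
by case: (ltngtP i j) => [_|_|/val_inj E] //=; rewrite E eqxx in nij.
Qed.

HB.instance Definition _ := Lmodule_hasFinDim.Build R H herm_vector_axiom.

End HermVector.

Definition posdef (R : rcfType) (n : nat) (A : herm R n) : Prop :=
  forall x : 'cV[R[i]]_n, x != 0 -> 0 < (x ^t* *m hval A *m x) 0 0.

(* The real parts of the roots of the characteristic polynomial, listed with
   multiplicity; when all eigenvalues of M are real, as for A^-1 B with A and B
   positive definite, these are the eigenvalues of M. *)
Definition eigs (R : rcfType) (n : nat) (M : 'M[R[i]]_n) : seq R :=
  [seq complex.Re z | z <- sval (closed_field_poly_normal (char_poly M))].

Definition rel_eigs (R : rcfType) (n : nat) (A B : herm R n) : seq R :=
  eigs (invmx (hval A) *m hval B).

(* The default value [head 0 _] belongs to the list unless the list is empty,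
   i.e. unless n = 0. *)
Definition lambda_max (R : rcfType) (n : nat) (A B : herm R n) : R :=
  \big[Num.max/head 0 (rel_eigs A B)]_(l <- rel_eigs A B) l.

Definition lambda_min (R : rcfType) (n : nat) (A B : herm R n) : R :=
  \big[Num.min/head 0 (rel_eigs A B)]_(l <- rel_eigs A B) l.

Definition thompson (R : realType) (n : nat) (A B : herm R n) : R :=
  \big[Num.max/0]_(l <- rel_eigs A B) `|ln l|.

Definition midpoints (R : realType) (n : nat) (A B : herm R n) :
    set (herm R n) :=
  [set C | [/\ posdef C, thompson A C = 2^-1 * thompson A B
             & thompson C B = 2^-1 * thompson A B]].

Definition aff (R : fieldType) (V : vectType R) (S : set V) : set V :=
  [set x | exists m (t : 'I_m -> R) (c : 'I_m -> V),
     [/\ forall i, S (c i), \sum_i t i = 1 & x = \sum_i t i *: c i]].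

(* [affine_dim W d]: W is a (nonempty) affine subspace of dimension d; such a d
   is unique, the direction U being determined by W. *)
Definition affine_dim (R : fieldType) (V : vectType R) (W : set V) (d : nat) :
    Prop :=
  exists (x : V) (U : {vspace V}),
    W = [set x + u | u in [set u | u \in U]] /\ \dim U = d.

(* Main.v *)
Require Import Defs.
From HB Require Import structures.
From mathcomp Require Import all_boot all_order all_algebra.
From mathcomp Require Import sesquilinear spectral complex.
From mathcomp Require Import classical_sets reals sequences exp.
From mathcomp Require Import ring lra.

(** Write $X \le Y$ for the Loewner order and $s = e^{d_T(A,B)/2}$.  Thompson's
    metric is governed by this order: $d_T(A,B) \le t$ if and only if
    $e^{-t} A \le B \le e^t A$ ([thompson_le]).  Hence the triangle inequality,
    and hence $C$ is a midpoint if and only if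
    $s^{-1} A \le C \le s A$ and $s^{-1} C \le B \le s C$ ([midpointsP]).

    Both $A$ and $B$ are diagonalised by one congruence, $A = T^* T$ and
    $B = T^* \mathrm{diag}(x_i^2) T$ ([simdiag]); the $x_i^2$ are then the
    eigenvalues of $A^{-1} B$ ([rel_eigs_simdiag]).  For $C = T^* X T$ the four
    inequalities become $s^{-1} I \le X \le s I$ and
    $s^{-1} X \le \mathrm{diag}(x_i^2) \le s X$, where
    $s^{-1} \le x_i \le s$.  The matrix $\mathrm{diag}(x_i)$ is a solution (its
    image under the congruence is the geometric mean of $A$ and $B$), and it
    turns out to be as interior as a solution can be:

    - if $x_i = s$ or $x_i = s^{-1}$, two of the inequalities pinch the diagonal
      entry $X_{ii}$ to the value $x_i$; a positive semidefinite matrix with a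
      zero diagonal entry has a zero column there, so the whole $i$-th column of
      $X$ is $x_i e_i$ ([sandwich_col]);
    - on the remaining indices, those with $s^{-1} < x_i < s$, all four
      inequalities are strict at $\mathrm{diag}(x_i)$, so every Hermitian
      perturbation supported there is allowed if it is small ([sandwich_near]).

    The affine span of the solutions is therefore $\mathrm{diag}(x_i)$ plus the
    space of Hermitian matrices supported on these remaining indices
    ([affine_dim_aff]).  There are $k$ of them, because the largest value of
    $\max(\mu, \mu^{-1})$ over the spectrum is $s^2$ ([max_extremal_expR]), and
    the Hermitian matrices of size $k$ have real dimension $k^2$. *)

Set Implicit Arguments.
Unset Strict Implicit.
Unset Printing Implicit Defensive.

Import Order.TTheory GRing.Theory Num.Theory.
Local Open Scope ring_scope.
Local Open Scope sesquilinear_scope.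
Local Open Scope complex_scope.

(** * Congruences and diagonal matrices *)

Lemma adjmxM (R : rcfType) m n p (M : 'M[R[i]]_(m, n)) (N : 'M_(n, p)) :
  (M *m N)^t* = N^t* *m M^t*.
Proof. by rewrite trmx_mul map_mxM. Qed.

Lemma hval_adj (R : rcfType) n (A : herm R n) : (hval A)^t* = hval A.
Proof.
have /hermP hA : hval A \is hermsymmx by exact: (valP A).
by apply/matrixP => i j; rewrite !mxE [RHS]hA.
Qed.

Lemma mxherm_adj (R : rcfType) n (M : 'M[R[i]]_n) : M^t* = M -> M \is hermsymmx.
Proof. by move=> E; apply/hermP => i j; rewrite -{1}E !mxE. Qed.

Section Congruence.
Variables (R : rcfType).
Local Notation C := R[i].

Fact hcongr_subproof m n (T : 'M[C]_(m, n)) (X : herm R m) :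
  T^t* *m hval X *m T \is hermsymmx.
Proof. by apply: mxherm_adj; rewrite !adjmxM trmxCK hval_adj mulmxA. Qed.

(** The congruence $X \mapsto T^* X T$; $T$ may be rectangular, which also makes
    it the inclusion of the matrices supported on a block. *)
Definition hcongr m n (T : 'M[C]_(m, n)) (X : herm R m) : herm R n :=
  HermitianMx (hcongr_subproof T X).

Lemma hval_hcongr m n (T : 'M[C]_(m, n)) X :
  hval (hcongr T X) = T^t* *m hval X *m T.
Proof. by []. Qed.

Lemma hcongr_is_linear m n (T : 'M[C]_(m, n)) : linear (hcongr T).
Proof.
move=> a X Y; apply: hval_inj.
by rewrite !(hvalD, hvalZ, hval_hcongr) mulmxDr mulmxDl -scalemxAr -scalemxAl.
Qed.
HB.instance Definition _ m n (T : 'M[C]_(m, n)) :=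
  GRing.isLinear.Build R (herm R m) (herm R n) *:%R (hcongr T)
    (hcongr_is_linear T).

Lemma hcongrM m n p (S : 'M[C]_(n, p)) (T : 'M[C]_(m, n)) X :
  hcongr S (hcongr T X) = hcongr (T *m S) X.
Proof. by apply: hval_inj; rewrite !hval_hcongr adjmxM !mulmxA. Qed.

Lemma hcongr1 n (X : herm R n) : hcongr 1%:M X = X.
Proof.
by apply: hval_inj; rewrite hval_hcongr mulmx1 trmx1 map_mx1 mul1mx.
Qed.

Lemma hcongrK n (T : 'M[C]_n) X :
  T \in unitmx -> hcongr T (hcongr (invmx T) X) = X.
Proof. by move=> uT; rewrite hcongrM mulVmx // hcongr1. Qed.

Fact hdiag_subproof n (d : 'I_n -> R) :
  diag_mx (\row_i (d i)%:C) \is hermsymmx.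
Proof.
apply/hermP => i j; rewrite !mxE rmorphMn /= oppr0 eq_sym.
by case: eqP => [->|].
Qed.

Definition hdiag n (d : 'I_n -> R) : herm R n := HermitianMx (hdiag_subproof d).

Lemma hval_hdiag n (d : 'I_n -> R) :
  hval (hdiag d) = diag_mx (\row_i (d i)%:C).
Proof. by []. Qed.

Lemma hval_hdiag1 n : hval (@hdiag n (fun=> 1)) = 1%:M.
Proof. by apply/matrixP => i j; rewrite hval_hdiag !mxE. Qed.

End Congruence.

(** * Quadratic forms and the Loewner order *)

Section QuadraticForm.
Variables (R : rcfType).
Local Notation C := R[i].

Definition qf n (A : herm R n) (x : 'cV[C]_n) : R :=
  complex.Re ((x^t* *m hval A *m x) 0 0).

Definition abs2 (z : C) : R := complex.Re z ^+ 2 + complex.Im z ^+ 2.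

Lemma abs2_ge0 z : 0 <= abs2 z.
Proof. by rewrite addr_ge0 // sqr_ge0. Qed.

Lemma abs2_eq0 z : (abs2 z == 0) = (z == 0).
Proof. by rewrite paddr_eq0 ?sqr_ge0 // !sqrf_eq0 eq_complex. Qed.

(** The form takes real values because its matrix is Hermitian, so [qf] loses
    nothing by keeping only the real part. *)
Lemma qfC n (A : herm R n) x : (x^t* *m hval A *m x) 0 0 = (qf A x)%:C.
Proof.
have /matrixP/(_ 0 0): (x^t* *m hval A *m x)^t* = x^t* *m hval A *m x.
  by rewrite !adjmxM trmxCK hval_adj mulmxA.
rewrite 2!mxE /qf; case: (_ 0 0) => a b /= [] /eqP.
by rewrite eq_sym -addr_eq0 -mulr2n mulrn_eq0 /= => /eqP ->.
Qed.

Lemma qfD n (A B : herm R n) x : qf (A + B) x = qf A x + qf B x.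
Proof.
by apply: complexI; rewrite rmorphD /= -!qfC hvalD mulmxDr mulmxDl mxE.
Qed.

Lemma qfZ n a (A : herm R n) x : qf (a *: A) x = a * qf A x.
Proof.
by apply: complexI; rewrite rmorphM /= -!qfC hvalZ -scalemxAr -scalemxAl mxE.
Qed.

Lemma qfN n (A : herm R n) x : qf (- A) x = - qf A x.
Proof. by rewrite -scaleN1r qfZ mulN1r. Qed.

Lemma qf_hcongr m n (T : 'M[C]_(m, n)) X x :
  qf (hcongr T X) x = qf X (T *m x).
Proof. by rewrite /qf hval_hcongr adjmxM !mulmxA. Qed.

Lemma qf_hdiag n (d : 'I_n -> R) x :
  qf (hdiag d) x = \sum_i d i * abs2 (x i 0).
Proof.
apply: complexI; rewrite -qfC hval_hdiag -mulmxA mxE rmorph_sum /=.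
apply: eq_bigr => i _; rewrite mul_diag_mx !mxE.
case: (x i 0) => a b; apply/eqP; rewrite /abs2 eq_complex /=.
by apply/andP; split; apply/eqP; ring.
Qed.

Lemma posdefP n (A : herm R n) :
  posdef A <-> forall x, x != 0 -> 0 < qf A x.
Proof.
by split=> h x /h; rewrite qfC ltcE /= eqxx.
Qed.

Definition loewner n (A B : herm R n) : Prop := forall x, qf A x <= qf B x.

Lemma loewner_hcongr n (T : 'M[C]_n) X Y : T \in unitmx ->
  loewner (hcongr T X) (hcongr T Y) <-> loewner X Y.
Proof.
move=> uT; split=> h x; last by rewrite !qf_hcongr.
by have := h (invmx T *m x); rewrite !qf_hcongr mulKVmx.
Qed.

Lemma loewner_trans n (Y X Z : herm R n) :
  loewner X Y -> loewner Y Z -> loewner X Z.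
Proof. by move=> h1 h2 x; apply: le_trans (h1 x) (h2 x). Qed.

Lemma loewner_scale n (a : R) (X Y : herm R n) :
  0 <= a -> loewner X Y -> loewner (a *: X) (a *: Y).
Proof. by move=> a0 h x; rewrite !qfZ ler_wpM2l. Qed.

Lemma qf_hdiag_delta n (d : 'I_n -> R) i : qf (hdiag d) (delta_mx i 0) = d i.
Proof.
rewrite qf_hdiag (bigD1 i) //= big1 => [|j /negPf nji].
  by rewrite mxE !eqxx /abs2 /= expr1n expr0n !addr0 mulr1.
by rewrite mxE nji /abs2 /= expr0n addr0 mulr0.
Qed.

Lemma loewner_hdiag n (c d : 'I_n -> R) :
  loewner (hdiag c) (hdiag d) <-> forall i, c i <= d i.
Proof.
split=> h i; first by rewrite -!qf_hdiag_delta h.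
by rewrite !qf_hdiag ler_sum // => j _; rewrite ler_wpM2r ?abs2_ge0.
Qed.

Lemma hdiagZ n a (d : 'I_n -> R) : a *: hdiag d = hdiag (fun i => a * d i).
Proof.
apply: hval_inj; rewrite hvalZ !hval_hdiag; apply/matrixP => i j.
by rewrite !mxE mulrnAr rmorphM.
Qed.

End QuadraticForm.

(** * Simultaneous diagonalisation *)

Section SimultaneousDiagonalization.
Variable R : rcfType.
Local Notation C := R[i].

Lemma spectral_herm n (A : herm R n) :
  exists (P : 'M[C]_n) (d : 'I_n -> R),
    P \is unitarymx /\ A = hcongr P (hdiag d).
Proof.
have hA : hval A \is hermsymmx by exact: (valP A).
have /orthomx_spectralP E := hermitian_normalmx hA.
have /mxOverP sr := hermitian_spectral_diag_real hA.
exists (spectralmx (hval A)), (fun i => complex.Re (spectral_diag (hval A) 0 i)).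
split; first exact: spectral_unitarymx.
apply: hval_inj; rewrite hval_hcongr hval_hdiag {1}E.
rewrite invmx_unitary ?spectral_unitarymx //; congr (_ *m diag_mx _ *m _).
by apply/rowP => i; rewrite mxE RRe_real.
Qed.

Lemma unitary_hcongr1 n (P : 'M[C]_n) :
  P \is unitarymx -> hcongr P (hdiag (fun=> 1)) = hdiag (fun=> 1).
Proof.
move=> uP; apply: hval_inj; rewrite hval_hcongr hval_hdiag1 mulmx1.
by rewrite -invmx_unitary // mulVmx // unitarymx_unit.
Qed.

(** The spectral theorem for $A = P^* \mathrm{diag}(a) P$ gives a square root
    $L = \mathrm{diag}(\sqrt{a}) P$ with $A = L^* L$; the spectral theorem for
    $L^{-*} B L^{-1} = Q^* \mathrm{diag}(d) Q$ then gives $T = Q L$, since the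
    unitary $Q$ does not change $L^* L$. *)
Lemma simdiag n (A B : herm R n) : posdef A ->
  exists (T : 'M[C]_n) (d : 'I_n -> R),
    [/\ T \in unitmx, A = hcongr T (hdiag (fun=> 1)) & B = hcongr T (hdiag d)].
Proof.
move=> /posdefP pA.
have [P [a [uP EA]]] := spectral_herm A.
have uP' := unitarymx_unit uP.
have a_gt0 i : 0 < a i.
  have := pA (invmx P *m delta_mx i 0).
  rewrite EA qf_hcongr mulKVmx // qf_hdiag_delta; apply.
  apply/eqP => /(congr1 (mulmx P)); rewrite mulKVmx // mulmx0 => /matrixP/(_ i 0).
  by rewrite !mxE !eqxx => /eqP; rewrite oner_eq0.
pose s := diag_mx (\row_i (Num.sqrt (a i))%:C) : 'M[C]_n.
have us : s \in unitmx.
  rewrite unitmxE det_diag unitfE; apply/prodf_neq0 => i _.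
  by rewrite mxE eq_complex /= eqxx andbT gt_eqF // sqrtr_gt0.
have Es : hcongr s (hdiag (fun=> 1)) = hdiag a.
  apply: hval_inj; rewrite hval_hcongr hval_hdiag1 mulmx1 hval_hdiag.
  apply/matrixP => i j; rewrite mul_mx_diag !mxE.
  rewrite rmorphMn eq_sym; case: eqP => [->|_]; last by rewrite !mulr0n mul0r.
  rewrite !mulr1n [X in X * _]conjc_real -rmorphM -expr2 sqr_sqrtr //.
  exact: ltW.
pose L := s *m P.
have uL : L \in unitmx by rewrite unitmx_mul us.
have [Q [d [uQ EB]]] := spectral_herm (hcongr (invmx L) B).
exists (Q *m L), d; split.
- by rewrite unitmx_mul uL unitarymx_unit.
- by rewrite -hcongrM unitary_hcongr1 // /L -hcongrM Es.
- by rewrite -hcongrM -EB hcongrK.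
Qed.

Lemma posdef_simdiag n (T : 'M[C]_n) (d : 'I_n -> R) : T \in unitmx ->
  posdef (hcongr T (hdiag d)) <-> forall i, 0 < d i.
Proof.
move=> uT; split=> [/posdefP h i|h].
  have := h (invmx T *m delta_mx i 0).
  rewrite qf_hcongr mulKVmx // qf_hdiag_delta; apply.
  apply/eqP => /(congr1 (mulmx T)); rewrite mulKVmx // mulmx0 => /matrixP/(_ i 0).
  by rewrite !mxE !eqxx => /eqP; rewrite oner_eq0.
apply/posdefP => x x0; rewrite qf_hcongr qf_hdiag lt_def sumr_ge0 ?andbT; last first.
  by move=> i _; rewrite mulr_ge0 ?abs2_ge0 // ltW.
rewrite psumr_neq0; last by move=> i _; rewrite mulr_ge0 ?abs2_ge0 // ltW.
have Tx0 : T *m x != 0.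
  by apply: contraNneq x0 => E; rewrite -(mulKmx uT x) E mulmx0.
have [i Txi] : exists i, (T *m x) i 0 != 0.
  by case/cV0Pn: Tx0 => i Txi; exists i.
apply/hasP; exists i; first by rewrite mem_index_enum.
by rewrite /= mulr_gt0 // lt_def abs2_eq0 Txi abs2_ge0.
Qed.

Lemma char_poly_conj (F : fieldType) n (S D : 'M[F]_n) : S \in unitmx ->
  char_poly (invmx S *m D *m S) = char_poly D.
Proof.
move=> uS; rewrite /char_poly.
have SVS : map_mx polyC (invmx S) *m map_mx polyC S = 1%:M.
  by rewrite -map_mxM mulVmx // map_mx1.
have -> : char_poly_mx (invmx S *m D *m S) =
    map_mx polyC (invmx S) *m char_poly_mx D *m map_mx polyC S.
  rewrite /char_poly_mx mulmxBr mulmxBl !map_mxM; congr (_ - _).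
  by rewrite scalar_mxC -mulmxA SVS mulmx1.
by rewrite !det_mulmx mulrAC -det_mulmx SVS det1 mul1r.
Qed.

(** Here $A^{-1} B = T^{-1} \mathrm{diag}(d) T$, which has the characteristic
    polynomial of $\mathrm{diag}(d)$. *)
Lemma rel_eigs_simdiag n (T : 'M[C]_n) (d : 'I_n -> R) : T \in unitmx ->
  perm_eq (rel_eigs (hcongr T (hdiag (fun=> 1))) (hcongr T (hdiag d)))
          (codom d).
Proof.
move=> uT; rewrite /rel_eigs /eigs.
have uT' : T^t* \in unitmx by rewrite map_unitmx unitmx_tr.
rewrite !hval_hcongr hval_hdiag1 mulmx1.
have -> : invmx (T^t* *m T) *m (T^t* *m hval (hdiag d) *m T) =
          invmx T *m hval (hdiag d) *m T.
  rewrite -[in RHS](mulKmx uT' (hval (hdiag d))) !mulmxA; congr (_ *m _ *m _ *m _).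
  have uTT : T^t* *m T \in unitmx by rewrite unitmx_mul uT'.
  apply: (can_inj (mulKmx uTT)); rewrite mulmxV //.
  by rewrite mulmxA -(mulmxA _ T) mulmxV // mulmx1 mulmxV.
rewrite char_poly_conj //; case: closed_field_poly_normal => r E.
rewrite [sval _]/=; move: E; rewrite (monicP (char_poly_monic _)) scale1r.
rewrite char_poly_trig; last by rewrite hval_hdiag diag_mx_is_trig.
move=> E; rewrite -[codom d]map_id codomE -map_comp.
have -> : [seq (id \o d) x | x <- enum 'I_n] =
    [seq complex.Re z | z <- [seq (d i)%:C | i <- enum 'I_n]].
  by rewrite -map_comp.
apply: perm_map; apply: prod_XsubC_eq; rewrite -E big_map big_enum /=.
by apply: eq_bigr => i _; rewrite !mxE eqxx.
Qed.

End SimultaneousDiagonalization.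

(** * Positive semidefinite matrices *)

Section Rigidity.
Variable R : rcfType.
Local Notation C := R[i].

Lemma posdef1 n : posdef (@hdiag R n (fun=> 1)).
Proof.
apply/posdefP => x /cV0Pn[i xi]; rewrite qf_hdiag.
rewrite (bigD1 i) //= ltr_pwDl ?sumr_ge0 // => [|j _]; rewrite mul1r ?abs2_ge0 //.
by rewrite lt_def abs2_eq0 xi abs2_ge0.
Qed.

(** Diagonalise $M = T^* \mathrm{diag}(d) T$ with $d \ge 0$: the diagonal entry is
    $\sum_j d_j |T_{ji}|^2$, so it vanishes only if every $d_j T_{ji}$ does, and
    these are the factors in the entries of the $i$-th column. *)
Lemma psd_null_col n (M : herm R n) i :
  (forall x, 0 <= qf M x) -> qf M (delta_mx i 0) = 0 ->
  forall j, hval M j i = 0.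
Proof.
move=> M0; have [T [d [uT _ EM]]] := simdiag M (@posdef1 n).
have d0 j : 0 <= d j.
  by have := M0 (invmx T *m delta_mx j 0); rewrite EM qf_hcongr mulKVmx // qf_hdiag_delta.
rewrite EM qf_hcongr qf_hdiag => /eqP.
rewrite psumr_eq0 => [/allP h j|j _]; last by rewrite mulr_ge0 ?abs2_ge0.
rewrite hval_hcongr -mulmxA mxE big1 // => k _; rewrite mul_diag_mx !mxE.
have /eqP := h k (mem_index_enum _).
rewrite -colE mxE /= => /eqP; rewrite mulf_eq0 abs2_eq0.
by case/orP=> /eqP->; rewrite ?mul0r ?mulr0 ?mul0r ?mulr0.
Qed.

(** This is [psd_null_col] for $Y - X$. *)
Lemma loewner_tight_col n (X Y : herm R n) i :
  loewner X Y -> qf X (delta_mx i 0) = qf Y (delta_mx i 0) ->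
  forall j, hval X j i = hval Y j i.
Proof.
move=> lXY E j; apply/eqP; rewrite eq_sym -subr_eq0; apply/eqP.
have -> : hval Y j i - hval X j i = hval (Y - X) j i by rewrite hvalD !mxE.
by apply: psd_null_col => [x|]; rewrite qfD qfN ?subr_ge0 // E subrr.
Qed.

(** After simultaneous diagonalisation $A$ is the sum of squares, and the sum of
    the absolute values of the coefficients of $Y$ is a bound. *)
Lemma qf_bounded n (A Y : herm R n) : posdef A ->
  exists2 K : R, 0 < K & forall x, `|qf Y x| <= K * qf A x.
Proof.
move=> /(simdiag Y)[T [d [_ -> ->]]].
exists (1 + \sum_i `|d i|) => [|x].
  by rewrite ltr_pwDl // sumr_ge0.
rewrite !qf_hcongr !qf_hdiag mulr_sumr; apply: le_trans (ler_norm_sum _ _ _) _.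
apply: ler_sum => i _; rewrite normrM mul1r (ger0_norm (abs2_ge0 _)).
rewrite ler_wpM2r ?abs2_ge0 // (bigD1 i) //= addrCA lerDl addr_ge0 // sumr_ge0 //.
Qed.

End Rigidity.

(** * Hermitian matrices supported on a set of indices *)

Section Selection.
Variables (R : rcfType) (n : nat) (F : {set 'I_n}).
Local Notation C := R[i].

(** The $|F| \times n$ coordinate restriction to $F$. *)
Definition selmx : 'M[C]_(#|F|, n) := \matrix_(a, j) (enum_val a == j)%:R.

Lemma selmx_mul (x : 'cV[C]_n) a : (selmx *m x) a 0 = x (enum_val a) 0.
Proof.
rewrite mxE (bigD1 (enum_val a)) //= big1 => [|j /negPf nj].
  by rewrite mxE eqxx mul1r addr0.
by rewrite mxE eq_sym nj mul0r.
Qed.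

Lemma selmx_coisometry : selmx *m selmx^t* = 1%:M.
Proof.
apply/matrixP => a b; rewrite mxE (bigD1 (enum_val a)) //= big1 => [|j /negPf nj].
  by rewrite !mxE eqxx mul1r addr0 (inj_eq enum_val_inj) eq_sym conjC_nat.
by rewrite mxE eq_sym nj mul0r.
Qed.

Lemma selmx_proj : selmx^t* *m selmx = diag_mx (\row_i (i \in F)%:R).
Proof.
apply/matrixP => i j; rewrite !mxE.
have -> : \sum_a (selmx^t*) i a * selmx a j =
          \sum_(a < #|F|) (enum_val a == i)%:R * (enum_val a == j)%:R :> C.
  by apply: eq_bigr => a _; rewrite !mxE conjC_nat.
have -> : \sum_(a : 'I_#|F|) (enum_val a == i)%:R * (enum_val a == j)%:R =
   \sum_(k in F) (k == i)%:R * (k == j)%:R :> C.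
  by rewrite [RHS]big_enum_val.
have [iF|iF] := boolP (i \in F).
  rewrite (bigD1 i) //= eqxx mul1r big1 ?addr0 => [|k /andP[_ /negPf->]].
    by case: eqP.
  by rewrite mul0r.
rewrite big1 ?mul0rn // => k kF.
by rewrite (_ : k == i = false) ?mul0r //; apply: contraNF iF => /eqP <-.
Qed.

(** The columns outside $F$ are assumed to vanish; the rows do so by Hermitian
    symmetry. *)
Lemma hcongr_selmx_supp (M : herm R n) :
  (forall i j, i \notin F -> hval M j i = 0) ->
  hcongr selmx (hcongr (selmx^t*) M) = M.
Proof.
move=> h; apply: hval_inj; rewrite hcongrM selmx_proj hval_hcongr.
apply/matrixP => i j; rewrite mul_mx_diag mxE mulrC mxE.
have [jF|jF] := boolP (j \in F); last by rewrite mul0r h.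
have /hermP hM : hval M \is hermsymmx by exact: (valP M).
rewrite mul1r tr_diag_mx map_diag_mx mul_diag_mx !mxE rmorph_nat.
have [iF|iF] := boolP (i \in F); first by rewrite mul1r.
by rewrite mul0r hM h // rmorph0.
Qed.

(** The restriction of $\mathrm{diag}(m)$ to $F$ is positive definite, so it bounds
    a multiple of $Y$ by [qf_bounded]; the entries of $m$ outside $F$ only
    enlarge the right-hand side. *)
Lemma selmx_absorb (m : 'I_n -> R) (Y : herm R #|F|) :
  (forall i, 0 <= m i) -> (forall i, i \in F -> 0 < m i) ->
  exists2 e : R, 0 < e &
    forall x, `|qf (e *: hcongr selmx Y) x| <= qf (hdiag m) x.
Proof.
move=> m0 mF.
have pA : posdef (hdiag (m \o enum_val : 'I_#|F| -> R)).
  rewrite -(hcongr1 (hdiag _)); apply/posdef_simdiag; first exact: unitmx1.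
  by move=> a; apply: mF; apply: enum_valP.
have [K K0 hK] := qf_bounded Y pA.
exists K^-1 => [|x]; first by rewrite invr_gt0.
rewrite qfZ qf_hcongr normrM (ger0_norm (ltW _)) ?invr_gt0 //.
rewrite ler_pdivrMl //; apply: le_trans (hK _) _.
rewrite ler_wpM2l ?(ltW K0) // !qf_hdiag.
under eq_bigr do rewrite selmx_mul /=.
rewrite -(big_enum_val (A := mem F) (fun i => m i * abs2 (x i 0))) /=.
rewrite [leRHS](bigID (mem F)) /= lerDl sumr_ge0 // => i _.
by rewrite mulr_ge0 ?abs2_ge0.
Qed.

End Selection.

(** * Thompson's metric *)

Section Thompson.
Variable R : realType.
Local Notation C := R[i].

(** In coordinates where $A = I$ and $B = \mathrm{diag}(d)$, both sides say that
    $e^{-t} \le d_i \le e^t$ for all $i$. *)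
Lemma thompson_le n (A B : herm R n) (t : R) : posdef A -> posdef B -> 0 <= t ->
  thompson A B <= t <->
  loewner (expR (- t) *: A) B /\ loewner B (expR t *: A).
Proof.
move=> pA pB t0; have [T [d [uT EA EB]]] := simdiag B pA.
have d0 : forall i, 0 < d i by rewrite -(posdef_simdiag _ uT) -EB.
have eigP l : l \in rel_eigs A B <-> exists i, l = d i.
  rewrite EA EB (perm_mem (rel_eigs_simdiag d uT)).
  by split=> [/codomP //|[i ->]]; apply: codom_f.
have -> : thompson A B <= t <-> forall i, `|ln (d i)| <= t.
  split=> [h i|h].
    apply: le_trans h.
    apply: (@le_bigmax_seq _ _ _ _ 0 (d i) xpredT (fun l => `|ln l|)) => //.
    by apply/eigP; exists i.
  rewrite /thompson big_seq; apply: bigmax_le => // l /eigP [i ->].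
  exact: h.
rewrite EA EB -!linearZ /= !hdiagZ !loewner_hcongr // !loewner_hdiag.
split=> [h|[h1 h2] i].
  split=> i; have := h i; rewrite ler_norml => /andP[h1 h2]; rewrite mulr1.
    by rewrite -(lnK (d0 i)) ler_expR.
  by rewrite -(lnK (d0 i)) ler_expR.
rewrite ler_norml -(ler_expR (- t)) -(ler_expR (ln _)) (lnK (d0 i)).
by have := h1 i; have := h2 i; rewrite !mulr1 => -> ->.
Qed.

Lemma thompson_ge0 n (A B : herm R n) : 0 <= thompson A B.
Proof. exact: bigmax_ge_id. Qed.

(** Scaling and transitivity of the Loewner order give
    $B \le e^{d_T(C,B)} C \le e^{d_T(C,B)} e^{d_T(A,C)} A$, and similarly below. *)
Lemma thompson_triangle n (A B C : herm R n) :
  posdef A -> posdef B -> posdef C ->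
  thompson A B <= thompson A C + thompson C B.
Proof.
move=> pA pB pC.
have [l1 u1] := (thompson_le pA pC (thompson_ge0 A C)).1 (lexx _).
have [l2 u2] := (thompson_le pC pB (thompson_ge0 C B)).1 (lexx _).
apply: (thompson_le pA pB _).2; first by rewrite addr_ge0 ?thompson_ge0.
rewrite addrC opprD !expRD -!scalerA; split.
  by apply: loewner_trans (loewner_scale (expR_ge0 _) l1) l2.
by apply: loewner_trans u2 (loewner_scale (expR_ge0 _) u1).
Qed.

(** The inequalities say that both distances are at most half of $d_T(A,B)$; the
    triangle inequality forces equality. *)
Lemma midpointsP n (A B C : herm R n) (s := expR (2^-1 * thompson A B)) :
  posdef A -> posdef B ->
  midpoints A B C <->
  [/\ loewner (s^-1 *: A) C, loewner C (s *: A),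
      loewner (s^-1 *: C) B & loewner B (s *: C)].
Proof.
move=> pA pB; have h0 : 0 <= 2^-1 * thompson A B.
  by rewrite mulr_ge0 ?invr_ge0 ?ler0n ?thompson_ge0.
rewrite /s -expRN; split=> [[pC dAC dCB]|[l1 u1 l2 u2]].
  have [|l1 u1] := (thompson_le pA pC h0).1; first by rewrite dAC lexx.
  have [|l2 u2] := (thompson_le pC pB h0).1; first by rewrite dCB lexx.
  split; [exact: l1|exact: u1|exact: l2|exact: u2].
have pC : posdef C.
  apply/posdefP => x x0; apply: lt_le_trans (l1 x).
  by rewrite qfZ mulr_gt0 ?expR_gt0 //; move/posdefP: pA; apply.
have d1 := (thompson_le pA pC h0).2 (conj l1 u1).
have d2 := (thompson_le pC pB h0).2 (conj l2 u2).
have d3 := thompson_triangle pA pB pC.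
suff [e1 e2] : thompson A C = 2^-1 * thompson A B /\
    thompson C B = 2^-1 * thompson A B by split; [exact: pC|exact: e1|exact: e2].
move: d1 d2 d3; generalize (thompson A C) (thompson C B) (thompson A B).
by move=> a b t; lra.
Qed.

End Thompson.

(** * The diagonal midpoint problem *)

Lemma le_perturb (R : realDomainType) (a b v : R) :
  `|v| <= b - a -> a <= b + v /\ a + v <= b.
Proof. by rewrite ler_norml => /andP[h1 h2]; split; lra. Qed.

Section Sandwich.
Variables (R : rcfType) (n : nat) (s : R) (x : 'I_n -> R).
Local Notation C := R[i].
Hypotheses (s_gt0 : 0 < s) (x_lb : forall i, s^-1 <= x i) (x_ub : forall i, x i <= s).

(** The midpoint condition in the coordinates where $A = I$ and
    $B = \mathrm{diag}(x_i^2)$. *)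
Definition sandwich (X : herm R n) : Prop :=
  [/\ loewner (hdiag (fun=> s^-1)) X, loewner X (hdiag (fun=> s)),
      loewner (s^-1 *: X) (hdiag (fun i => x i ^+ 2)) &
      loewner (hdiag (fun i => x i ^+ 2)) (s *: X)].

(** If $x_i = s$ then $X_{ii} \le s$ and $s^2 \le s X_{ii}$, so $X \le s I$ is tight
    at $e_i$; if $x_i = s^{-1}$, the other two inequalities make
    $s^{-1} I \le X$ tight there. *)
Lemma sandwich_col X i : sandwich X -> x i = s \/ x i = s^-1 ->
  forall j, hval X j i = hval (hdiag x) j i.
Proof.
have V0 : 0 < s^-1 by rewrite invr_gt0.
have diagE c j : x i = c -> hval (hdiag (fun=> c)) j i = hval (hdiag x) j i.
  by move=> E; rewrite !hval_hdiag !mxE; case: eqP => // ->; rewrite E.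
case=> l1 u1 l2 u2 [E|E] j; rewrite -(diagE _ _ E).
  apply: loewner_tight_col => //.
  have := u1 (delta_mx i 0); have := u2 (delta_mx i 0).
  rewrite qfZ !qf_hdiag_delta E expr2 ler_pM2l // => h1 h2.
  by apply/eqP; rewrite eq_le h2.
symmetry; apply: loewner_tight_col => //.
have := l1 (delta_mx i 0); have := l2 (delta_mx i 0).
rewrite qfZ !qf_hdiag_delta E expr2 ler_pM2l // => h1 h2.
by apply/eqP; rewrite eq_le h2.
Qed.

(** Each inequality holds at $\mathrm{diag}(x)$ with a diagonal slack that is
    nonnegative, and positive on $F$.  The minimum $m$ of the four slacks absorbs
    small multiples of the perturbation by [selmx_absorb]. *)
Lemma sandwich_near (F : {set 'I_n}) (Y : herm R #|F|) :
  (forall i, i \in F -> s^-1 < x i < s) ->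
  exists2 e : R, 0 < e & sandwich (hdiag x + e *: hcongr (selmx R F) Y).
Proof.
move=> xF; have V0 : 0 < s^-1 by rewrite invr_gt0.
have x0 i : 0 < x i by apply: lt_le_trans (x_lb i).
pose m i := Num.min (Num.min (s - x i) (x i - s^-1))
                    (Num.min (s * x i ^+ 2 - x i) (x i - s^-1 * x i ^+ 2)).
(* The last two slacks are positive multiples of the first two. *)
have E1 i : s * x i ^+ 2 - x i = s * x i * (x i - s^-1).
  by field; rewrite gt_eqF.
have E2 i : x i - s^-1 * x i ^+ 2 = s^-1 * x i * (s - x i).
  by field; rewrite gt_eqF.
have m_ge0 i : 0 <= m i.
  rewrite !le_min E1 E2 !subr_ge0 x_lb x_ub /=.
  by rewrite !mulr_ge0 ?subr_ge0 ?x_lb ?x_ub // ltW.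
have m_gt0 i : i \in F -> 0 < m i.
  move=> /xF /andP[h1 h2]; rewrite !lt_min E1 E2 !subr_gt0 h1 h2 /=.
  by rewrite !mulr_gt0 ?subr_gt0.
have [e e0 he] := selmx_absorb Y m_ge0 m_gt0.
exists e; first exact: e0. set V := e *: _ in he *.
have qV a b z : (forall i, m i <= b i - a i) ->
    qf (hdiag a) z <= qf (hdiag b) z + qf V z /\
    qf (hdiag a) z + qf V z <= qf (hdiag b) z.
  move=> mba; apply: le_perturb; apply: le_trans (he z) _.
  rewrite !qf_hdiag -sumrB; apply: ler_sum => i _.
  by rewrite -mulrBl ler_wpM2r ?abs2_ge0.
have [m1 m2] : (forall i, m i <= x i - s^-1) /\ (forall i, m i <= s - x i).
  by split=> i; rewrite !ge_min lexx ?orbT.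
have [m3 m4] : (forall i, m i <= s * x i ^+ 2 - x i) /\
    (forall i, m i <= x i - s^-1 * x i ^+ 2).
  by split=> i; rewrite !ge_min lexx !orbT.
have sD := hdiagZ s (fun i => x i ^+ 2).
have sD' := hdiagZ s^-1 (fun i => x i ^+ 2).
split=> z; rewrite ?qfZ qfD.
- by have [] := qV (fun=> s^-1) x z m1.
- by have [] := qV x (fun=> s) z m2.
- by rewrite ler_pdivrMl // -qfZ sD; have [] := qV x _ z m3.
- by rewrite -ler_pdivrMl // -qfZ sD'; have [] := qV _ x z m4.
Qed.

End Sandwich.

(** * Affine spans *)

Section AffineHull.
Local Open Scope classical_set_scope.
Variables (R : realType) (V : vectType R).

(** A direction $u$ of $U$ is reached from the two points $c_0$ and $c_0 + e u$ of
    $S$: $c_0 + u = (1 - e^{-1}) c_0 + e^{-1} (c_0 + e u)$. *)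
Lemma affine_dim_aff (S : set V) (c0 : V) (U : {vspace V}) :
  (forall c, S c -> c - c0 \in U) ->
  (forall u, u \in U -> exists2 e : R, 0 < e & S (c0 + e *: u)) ->
  affine_dim (aff S) (\dim U).
Proof.
move=> SU US; exists c0, U; split=> //; apply/seteqP; split=> y /=.
  case=> m [t [c [Sc t1 ->]]].
  exists (\sum_i t i *: (c i - c0)).
    by apply: rpred_sum => i _; apply: rpredZ; apply: SU.
  under eq_bigr do rewrite scalerBr.
  by rewrite sumrB -scaler_suml t1 scale1r addrC subrK.
case=> u Uu <-; have [e e0 Se] := US _ Uu.
have Sc0 : S c0 by have [e' _] := US _ (mem0v U); rewrite scaler0 addr0.
exists 2, (fun i => if i == ord0 then 1 - e^-1 else e^-1),
  (fun i => if i == ord0 then c0 else c0 + e *: u).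
split; first by move=> i; case: ifP.
  by rewrite big_ord_recl big_ord1 /= subrK.
rewrite big_ord_recl big_ord1 /= scalerDr scalerA mulVf ?gt_eqF // scale1r addrA.
by rewrite -scalerDl subrK scale1r.
Qed.

End AffineHull.

(** * Extreme eigenvalues *)

Section Extremal.
Variable R : realType.

(** Both sides are the maximum of $\max(l, l^{-1}) = e^{|\ln l|}$ over the list.
    As the list is not empty, the initial values of the iterated maxima and
    minima do not affect the result. *)
Lemma max_extremal_expR (r : seq R) : r != [::] -> {in r, forall l, 0 < l} ->
  Num.max (\big[Num.max/head 0 r]_(l <- r) l) (\big[Num.min/head 0 r]_(l <- r) l)^-1 =
  expR (\big[Num.max/0]_(l <- r) `|ln l|).
Proof.
move=> r0 rpos; set lM := (X in Num.max X _); set lm := (X in X^-1).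
set d := (X in expR X).
have hr : head 0 r \in r by case: (r) r0 => // a r' _; rewrite inE eqxx.
have lm0 : 0 < lm.
  by rewrite /lm big_seq; elim/big_rec: _ => [|l y lr y0];
    rewrite ?lt_min ?y0 ?andbT; apply: rpos.
have ub l : l \in r -> l <= lM.
  by move=> lr; apply: (@le_bigmax_seq _ _ _ _ (head 0 r) l xpredT id).
have lb l : l \in r -> lm <= l.
  by move=> lr; apply: (@bigmin_inf_seq _ _ _ _ (head 0 r) l xpredT l id).
have dl l : l \in r -> `|ln l| <= d.
  by move=> lr; apply: (@le_bigmax_seq _ _ _ _ 0 l xpredT (fun l => `|ln l|)).
have dle l : l \in r -> expR (- d) <= l <= expR d.
  move=> lr; have := dl _ lr; rewrite ler_norml -(ler_expR (- d)) -(ler_expR (ln _)).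
  by rewrite lnK // posrE rpos.
apply/eqP; rewrite eq_le; apply/andP; split.
  rewrite ge_max; apply/andP; split.
    rewrite /lM big_seq; elim/big_rec: _ => [|l y lr yd]; rewrite ?ge_max ?yd ?andbT.
      by have /andP[] := dle _ hr.
    by have /andP[] := dle _ lr.
  rewrite -[leRHS]invrK lef_pV2 ?posrE ?invr_gt0 ?expR_gt0 // -expRN.
  rewrite /lm big_seq; elim/big_rec: _ => [|l y lr yd]; rewrite ?le_min ?yd ?andbT.
    by have /andP[] := dle _ hr.
  by have /andP[] := dle _ lr.
set M := Num.max _ _.
have M0 : 0 < M by rewrite lt_max invr_gt0 lm0 orbT.
have lnM l : l \in r -> `|ln l| <= ln M.
  move=> lr; have l0 := rpos _ lr; rewrite ler_norml; apply/andP; split.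
    rewrite -lnV ?posrE // ler_ln ?posrE ?invr_gt0 // -[leRHS]invrK.
    rewrite lef_pV2 ?posrE ?invr_gt0 // le_max; apply/orP; right.
    by rewrite lef_pV2 ?posrE ?lb.
  by rewrite ler_ln ?posrE // le_max ub.
rewrite -[leRHS](@lnK _ M) ?posrE // ler_expR /d big_seq.
elim/big_rec: _ => [|l y lr yd]; rewrite ?ge_max ?yd ?andbT.
  by apply: le_trans (lnM _ hr).
exact: lnM.
Qed.

End Extremal.

(** * The midpoint set *)

Section Midpoints.
Variable R : realType.
Local Notation C := R[i].

Lemma midpoints_sandwich n (T : 'M[C]_n) (A B : herm R n) (x : 'I_n -> R) X
    (s := expR (2^-1 * thompson A B)) :
  T \in unitmx -> posdef A -> posdef B ->
  A = hcongr T (hdiag (fun=> 1)) -> B = hcongr T (hdiag (fun i => x i ^+ 2)) ->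
  midpoints A B (hcongr T X) <-> sandwich s x X.
Proof.
move=> uT pA pB EA EB; rewrite (midpointsP _ pA pB) -/s.
have sA c : c *: A = hcongr T (hdiag (fun=> c)).
  by rewrite EA -linearZ /= hdiagZ; congr (hcongr T _); apply: hval_inj;
     rewrite !hval_hdiag; apply/matrixP => i j; rewrite !mxE mulr1.
rewrite !sA EB -!linearZ /= /sandwich.
have L Y Z := loewner_hcongr Y Z uT.
split=> [] [l1 u1 l2 u2].
  split; [exact: (L _ _).1 l1 | exact: (L _ _).1 u1 |
          exact: (L _ _).1 l2 | exact: (L _ _).1 u2].
split; [exact: (L _ _).2 l1 | exact: (L _ _).2 u1 |
        exact: (L _ _).2 l2 | exact: (L _ _).2 u2].
Qed.

Lemma hcongr_inj m n (T : 'M[C]_(m, n)) (S : 'M[C]_(n, m)) :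
  T *m S = 1%:M -> injective (hcongr T).
Proof.
by move=> TS; apply: (can_inj (g := hcongr S)) => X; rewrite hcongrM TS hcongr1.
Qed.

Lemma dim_hcongr_img m n (T : 'M[C]_(m, n)) : injective (hcongr T) ->
  \dim (linfun (hcongr T) @: fullv)%VS = (m ^ 2)%N.
Proof.
move=> injT; rewrite limg_dim_eq ?dimvf // capfv; apply/eqP.
by apply/lker0P => X Y; rewrite !lfunE; apply: injT.
Qed.

(** The index $i$ also ensures that the spectrum is not empty; for $n = 0$ the
    first identity fails, as its left-hand side is then $0$. *)
Lemma rel_eigs_bounds n (T : 'M[C]_n) (A B : herm R n) (x : 'I_n -> R)
    (s := expR (2^-1 * thompson A B)) :
  T \in unitmx -> (forall i, 0 < x i) ->
  A = hcongr T (hdiag (fun=> 1)) -> B = hcongr T (hdiag (fun i => x i ^+ 2)) ->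
  forall i, Num.max (lambda_max A B) (lambda_min A B)^-1 = s ^+ 2 /\
            s^-1 <= x i <= s.
Proof.
move=> uT x0 EA EB i.
have eigP l : l \in rel_eigs A B <-> exists i, l = x i ^+ 2.
  rewrite EA EB (perm_mem (rel_eigs_simdiag _ uT)).
  by split=> [/codomP //|[j ->]]; apply: codom_f.
have s2 : s ^+ 2 = expR (thompson A B).
  by rewrite -expRM_natl mulrA divff ?pnatr_eq0 // mul1r.
have iE : x i ^+ 2 \in rel_eigs A B by apply/eigP; exists i.
split.
  rewrite s2 /lambda_max /lambda_min max_extremal_expR //.
    by case: (rel_eigs A B) iE.
  by move=> l /eigP[j ->]; rewrite exprn_gt0.
have : `|ln (x i ^+ 2)| <= thompson A B.
  exact: (@le_bigmax_seq _ _ _ _ 0 (x i ^+ 2) xpredT (fun l => `|ln l|)).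
rewrite ler_norml -(ler_expR (- _)) -(ler_expR (ln _)) lnK ?posrE ?exprn_gt0 //.
rewrite expRN -s2 -exprVn => /andP[h1 h2].
have s0 : 0 < s by apply: expR_gt0.
by apply/andP; split; rewrite -(@ler_pXn2r _ 2) ?nnegrE ?invr_ge0 ?(ltW s0) ?(ltW (x0 i)).
Qed.

(** The indices not counted by $k$ are thus exactly those at which
    [sandwich_col] determines the column. *)
Lemma max_inv_sqr (s x : R) : 0 < x -> 0 < s -> s^-1 <= x <= s ->
  (Num.max (x ^+ 2) (x ^+ 2)^-1 == s ^+ 2) = (x == s) || (x == s^-1).
Proof.
move=> x0 s0 /andP[h1 h2]; have [x0' s0'] := (ltW x0, ltW s0).
have le1 : x ^+ 2 <= s ^+ 2 by rewrite ler_pXn2r ?nnegrE.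
have le2 : (x ^+ 2)^-1 <= s ^+ 2.
  rewrite -exprVn ler_pXn2r ?nnegrE ?invr_ge0 // -[leRHS]invrK.
  by rewrite lef_pV2 ?posrE ?invr_gt0.
have e1 : (x == s) = (x ^+ 2 == s ^+ 2) by rewrite eqrXn2.
have e2 : (x == s^-1) = ((x ^+ 2)^-1 == s ^+ 2).
  by rewrite -exprVn eqrXn2 ?invr_ge0 // (can2_eq (@invrK _) (@invrK _)).
rewrite e1 e2; apply/eqP/orP => [|[/eqP E|/eqP E]].
- by case: leP => _ ->; [right|left].
- by apply/eqP; rewrite eq_le ge_max le1 le2 le_max E lexx.
- by apply/eqP; rewrite eq_le ge_max le1 le2 le_max E lexx orbT.
Qed.

End Midpoints.

Theorem mainTheorem4 (R : realType) (n : nat) (A B : herm R n)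
    (hA : posdef A) (hB : posdef B) (k : nat)
    (hk : k = count (fun mu : R =>
                Num.max mu mu^-1
                  != Num.max (lambda_max A B) (lambda_min A B)^-1)
              (rel_eigs A B)) :
  affine_dim (aff (midpoints A B)) (k ^ 2)%N.
Proof.
have [T [d [uT EA EBd]]] := simdiag B hA.
have d0 : forall i, 0 < d i.
  by apply: (posdef_simdiag d uT).1; rewrite -EBd.
pose x i := Num.sqrt (d i).
have x0 i : 0 < x i by rewrite sqrtr_gt0.
have EB : B = hcongr T (hdiag (fun i => x i ^+ 2)).
  rewrite EBd; congr hcongr; apply: hval_inj; rewrite !hval_hdiag; congr diag_mx.
  by apply/rowP => i; rewrite !mxE sqr_sqrtr // ltW.
set s := expR (2^-1 * thompson A B).
have s0 : 0 < s by apply: expR_gt0.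
have bnd := rel_eigs_bounds uT x0 EA EB; rewrite -/s in bnd.
have midE X := midpoints_sandwich X uT hA hB EA EB; rewrite -/s in midE.
(* Midpoints are determined off F by sandwich_col and free on F by
   sandwich_near. *)
pose F := [set i | (x i != s) && (x i != s^-1)].
have kF : k = #|F|.
  rewrite hk; move: (rel_eigs_simdiag (fun i => x i ^+ 2) uT).
  rewrite -EA -EB => /permP ->.
  rewrite -sum1_count codomE big_map big_enum_cond -sum1_card /=.
  apply: eq_bigl => i; have [-> xi] := bnd i.
  by rewrite inE -negb_or max_inv_sqr.
rewrite kF.
pose E := selmx R F.
have injTE : injective (hcongr (E *m T)).
  apply: (@hcongr_inj _ _ _ _ (invmx T *m E^t*)).
  by rewrite mulmxA mulmxK // selmx_coisometry.
rewrite -(dim_hcongr_img injTE).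
(* The centre of the affine span is the geometric mean of A and B. *)
apply: (@affine_dim_aff _ _ _ (hcongr T (hdiag x))) => [D|u].
  rewrite -(hcongrK D uT) => /midE sX; rewrite -linearB /=.
  set X := hcongr _ D in sX *.
  rewrite -(@hcongr_selmx_supp _ _ F (X - hdiag x)) => [|i j iF].
    set Y := hcongr _ (X - _); rewrite hcongrM.
    by have := memv_img (linfun (hcongr (E *m T))) (memvf Y); rewrite lfunE.
  have xi : x i = s \/ x i = s^-1.
    by move: iF; rewrite inE -negb_or negbK => /orP[] /eqP; [left|right].
  by rewrite hvalD [LHS]mxE (sandwich_col s0 sX xi) !mxE subrr.
case/memv_imgP => Y _ ->; rewrite lfunE /= -hcongrM.
have [e e0 sY] : exists2 e : R, 0 < e &
    sandwich s x (hdiag x + e *: hcongr (selmx R F) Y).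
  apply: sandwich_near => // [i|i|i]; have [_ /andP[h1 h2]] := bnd i => //.
  by rewrite inE => /andP[xs xt]; rewrite !lt_def h1 h2 xt eq_sym xs.
exists e; first exact: e0.
by rewrite -linearZ -linearD /=; apply: (midE _).2.
Qed.
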